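(* Let $f\in\mathcal M_-$ be such that $\|d^*_+\|_\infty\le a$ and $\|s_2\|_\infty\le b$ for some $a>0$, $b>0$. Then for all $r\ge0$, $$\mathbf{Pr}(f^*_+\ge r)\le\exp\left[\frac ra-\left(\frac ra+\frac{b^2}{a^2}\right)\ln\left(1+\frac{ra}{b^2}\right)\right]\le\left(\frac{eb^2}{ra}\right)^{r/a},$$ where for $r=0$ the last expression is read as $1$.
   Context: $\mathcal M_-$ is the set of all real-valued supermartingales $f=(f_0,f_1,\ldots)$ (integrable, with $f_0\equiv0$) on some probability space with respect to some filtration $(F_0,F_1,\ldots)$ (both may depend on $f$). Put $d_0=0$, $d_j=f_j-f_{j-1}$ for $j\ge1$, $f^*_+=\sup_{j\ge0}f_j$, $d^*_+=\sup_{j\ge0}d_j$, $s_2=\left(\sum_{j=1}^\infty\mathbf E_{j-1}d_j^2\right)^{1/2}$, where $\mathbf E_{j-1}$ is the conditional expectation given $F_{j-1}$; $\|\cdot\|_\infty$ of a random variable is its essential supremum norm. *)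

(* Defs.v *)
From HB Require Import structures.
From mathcomp Require Import all_boot all_order all_algebra.
From mathcomp Require Import all_classical all_reals all_analysis.
From mathcomp Require Import measurable_realfun.

Set Implicit Arguments.
Unset Strict Implicit.
Unset Printing Implicit Defensive.

Import Order.TTheory GRing.Theory Num.Theory.
Import numFieldNormedType.Exports.

Local Open Scope classical_set_scope.
Local Open Scope ring_scope.
Local Open Scope ereal_scope.

Definition filtration {d : measure_display} {T : measurableType d}
    (F : nat -> set (set T)) : Prop :=
  [/\ forall n, sigma_algebra [set: T] (F n),
      forall n, F n `<=` measurable
    & forall m n, (m <= n)%N -> F m `<=` F n].

(* [Y] is a version of E[X | G].  Meant for [X] either integrable or
   nonnegative (possibly not integrable): testing with [A := {Y < 0}] and
   [A := {Y > 0}] shows that [Y] is then integrable, respectively nonnegative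
   almost everywhere, and that it is unique up to P-null sets. *)
Definition is_cond_exp {d : measure_display} {T : measurableType d}
    {R : realType} (P : probability T R) (G : set (set T))
    (X Y : T -> \bar R) : Prop :=
  preimage_set_system [set: T] Y measurable `<=` G /\
  forall A, G A -> \int[P]_(x in A) Y x = \int[P]_(x in A) X x.

Definition supermartingale {d : measure_display} {T : measurableType d}
    {R : realType} (P : probability T R) (F : nat -> set (set T))
    (f : nat -> T -> R) : Prop :=
  [/\ filtration F,
      forall n, preimage_set_system [set: T] (f n) measurable `<=` F n,
      forall n, P.-integrable [set: T] (EFin \o f n)
    & forall n, exists2 Y, is_cond_exp P (F n) (EFin \o f n.+1) Y &
        {ae P, forall x, Y x <= (f n x)%:E}].

Definition Mminus {d : measure_display} {T : measurableType d}
    {R : realType} (P : probability T R) (F : nat -> set (set T))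
    (f : nat -> T -> R) : Prop :=
  supermartingale P F f /\ forall x, f 0%N x = 0%R.

Definition diffseq {T : Type} {R : realType} (f : nat -> T -> R)
    (j : nat) (x : T) : R :=
  if j is i.+1 then (f i.+1 x - f i x)%R else 0%R.

(* g^*_+ = sup_{j >= 0} g_j, possibly +oo *)
Definition maxfun {T : Type} {R : realType} (g : nat -> T -> R) (x : T)
    : \bar R :=
  ereal_sup (range (fun j => (g j x)%:E)).

(* [s] is a version of (\sum_{j >= 1} E_{j-1} d_j^2)^{1/2}, possibly +oo:
   [V j] is a version of E_{j-1} d_j^2, and [V 0] is not used. *)
Definition is_s2 {d : measure_display} {T : measurableType d}
    {R : realType} (P : probability T R) (F : nat -> set (set T))
    (f : nat -> T -> R) (s : T -> \bar R) : Prop :=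
  exists2 V : nat -> T -> \bar R,
    forall j, (1 <= j)%N ->
      is_cond_exp P (F j.-1) (fun x => ((diffseq f j x) ^+ 2)%:E) (V j)
  & forall x, s x = sqrte (\sum_(1 <= j <oo) V j x).

(* Main.v *)
Require Import Defs.
From mathcomp Require Import all_boot all_order all_algebra.
From mathcomp Require Import all_classical all_reals all_analysis.
From mathcomp Require Import measurable_realfun ess_sup_inf.
From mathcomp Require Import ring lra.

(** This is Bennett's inequality in Freedman's martingale form, proved with an
exponential supermartingale and a stopping argument.

Fix lam > 0 and put psi = (e^(lam a) - 1 - lam a) / a^2.  Since
(e^y - 1 - y) / y^2 is nondecreasing in y, every increment d <= a satisfies
e^(lam d) <= 1 + lam d + psi d^2 ([expR_quadratic_bound]).  Taking conditional
expectations, where E d <= 0 and E d^2 = v, gives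
E e^(lam d) <= 1 + psi v <= e^(psi v), so that
M_n = exp(lam f_n - psi (v_1 + ... + v_n)) is a supermartingale
([integral_exp_step]).  Before f first reaches r this process is at
most e^(lam r); at that time it is at least e^(lam r - psi b^2), because
the conditional variances add up to at most b^2.  Since it starts at 1, the
event that f reaches r before a fixed time has probability at most
e^(psi b^2 - lam r) ([finite_horizon_bound]).  Continuity from below and r' -> r
from the left extend this to the event sup f >= r ([prob_maxfun_le]), and
lam = ln(1 + r a / b^2) / a yields the first inequality
([optimal_exponent]).  The second one follows from ln u <= ln(1 + u) and
0 <= ln(1 + u) with u = r a / b^2.

Conditional expectations are never computed: they enter through integrals over
the sets of the smaller sigma-algebra G.  The only fact needed is that if W has
nonnegative integral over every set of G, then so has Z W for every bounded
nonnegative G-measurable Z ([Rintegral_mul_ge0]). *)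

Set Implicit Arguments.
Unset Strict Implicit.
Unset Printing Implicit Defensive.

Import Order.TTheory GRing.Theory Num.Theory.
Import numFieldNormedType.Exports.

Local Open Scope classical_set_scope.
Local Open Scope ring_scope.

(** * Quadratic bounds on the exponential *)

(** Division by y^2 c^2 turns this into the monotonicity of
(e^y - 1 - y) / y^2 on the nonnegative reals, which is visible on its power
series: y^k c^2 <= c^k y^2 for each k >= 2. *)
Lemma expR_remainder_ratio (R : realType) (y c : R) : 0 <= y -> y <= c ->
  (expR y - 1 - y) * c ^+ 2 <= (expR c - 1 - c) * y ^+ 2.
Proof.
move=> y0 yc.
have expcvg (z w : R) : (series (exp_coeff z) n - 1 - z) * w ^+ 2 @[n --> \oo]
    --> (expR z - 1 - z) * w ^+ 2.
  apply: cvgMl; apply: cvgB; last exact: cvg_cst.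
  by apply: cvgB; [exact: is_cvg_series_exp_coeff|exact: cvg_cst].
have expS (z : R) n : series (exp_coeff z) n.+2 - 1 - z =
    \sum_(0 <= i < n) z ^+ i.+2 / i.+2`!%:R.
  rewrite /series /= big_nat_recl// big_nat_recl// /exp_coeff/=.
  by rewrite expr0 expr1 !divr1; ring.
(* Partial sums are compared from index 2 on, where the affine part has been
   cancelled. *)
apply: (ler_cvg_to (expcvg y c) (expcvg c y)).
exists 2%N => // -[|[|n]] //= _; rewrite !expS !mulr_suml.
apply: ler_sum => i _; rewrite mulrAC [leRHS]mulrAC ler_wpM2r ?invr_ge0//.
rewrite -addn2 !exprD mulrAC ler_wpM2r ?sqr_ge0// ler_wpM2r ?sqr_ge0//.
by rewrite lerXn2r// nnegrE (le_trans y0).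
Qed.

Lemma expR_ge1DxDx2 (R : realType) (u : R) : 0 <= u ->
  1 + u + u ^+ 2 / 2 <= expR u.
Proof.
move=> u0.
have -> : 1 + u + u ^+ 2 / 2 = series (exp_coeff u) 3.
  by rewrite /series/= !big_nat_recl// big_geq// /exp_coeff/= expr0 expr1 !divr1; ring.
apply: nondecreasing_cvgn_le; last exact: is_cvg_series_exp_coeff.
apply: nondecreasing_series => n _ _; exact: exp_coeff_ge0.
Qed.

(** For y = - u, the previous bound gives e^y <= 1 / (1 + u + u^2/2), and
(1 - u + u^2/2) (1 + u + u^2/2) = 1 + u^4/4 >= 1. *)
Lemma expR_le1DxDx2 (R : realType) (y : R) : y <= 0 ->
  expR y <= 1 + y + y ^+ 2 / 2.
Proof.
move=> y0.
have := @expR_ge1DxDx2 _ (- y); rewrite oppr_ge0 sqrrN => /(_ y0).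
set q := 1 + - y + y ^+ 2 / 2 => hq.
have q0 : 0 < q by rewrite /q; have := sqr_ge0 y; lra.
rewrite -[y in expR y]opprK expRN.
apply: (@le_trans _ _ q^-1).
  by rewrite lef_pV2 ?posrE ?expR_gt0.
rewrite -[leLHS]mul1r ler_pdivrMr//.
suff -> : (1 + y + y ^+ 2 / 2) * q = 1 + (y ^+ 2) ^+ 2 / 4.
  by rewrite lerDl divr_ge0// sqr_ge0.
by rewrite /q; field.
Qed.

(** The quadratic agrees with the exponential at c and is tangent to it at 0.
For negative y the ratio (e^y - 1 - y) / y^2 is at most 1/2, and at c it is at
least 1/2, so 1/2 separates the two. *)
Lemma expR_quadratic_bound (R : realType) (y c : R) : 0 < c -> y <= c ->
  expR y <= 1 + y + (expR c - 1 - c) / c ^+ 2 * y ^+ 2.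
Proof.
move=> c0 yc; have c20 : 0 < c ^+ 2 by rewrite exprn_gt0.
have [y0|/ltW y0] := leP 0 y.
  have := @expR_remainder_ratio R y c y0 yc.
  rewrite -ler_pdivlMr// mulrAC; lra.
have h1 := @expR_le1DxDx2 R y y0.
have h2 := @expR_ge1DxDx2 R c (ltW c0).
have : 1 / 2 * y ^+ 2 <= (expR c - 1 - c) / c ^+ 2 * y ^+ 2.
  apply: ler_wpM2r; first exact: sqr_ge0.
  by rewrite ler_pdivlMr//; lra.
lra.
Qed.

(** * Multiplying by a bounded function of a sub-sigma-algebra *)

Lemma EFin_integrableZl (d : measure_display) (T : measurableType d)
    (R : realType) (mu : {measure set T -> \bar R}) (k : R) (h : T -> R) :
  mu.-integrable [set: T] (EFin \o h) ->
  mu.-integrable [set: T] (EFin \o (fun x => k * h x)).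
Proof.
move=> ih; rewrite (_ : _ \o _ = (fun x => k%:E * (EFin \o h) x)%E).
  exact: integrableZl.
by apply/funext => x /=; rewrite EFinM.
Qed.

Section pull_out.
Context {d : measure_display} {T : measurableType d} {R : realType}.
Variables (P : probability T R) (G : set (set T)).
Hypotheses (GM : G.-sigma.-measurable `<=` d.-measurable).
Variable W : T -> R.
Hypothesis iW : P.-integrable [set: T] (EFin \o W).
Hypothesis W0 : forall A, G.-sigma.-measurable A -> 0 <= \int[P]_(x in A) W x.

Let T' : measurableType _ := g_sigma_algebraType G.

Lemma measurable_fun_coarse (Z : T -> R) :
  measurable_fun [set: T'] (Z : T' -> R) -> measurable_fun [set: T] Z.
Proof. by move=> mZ mT B mB; apply: GM; apply: mZ. Qed.

Lemma integrable_bounded_mul (Z : T -> R) K : measurable_fun [set: T] Z ->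
  (forall x, 0 <= Z x <= K) ->
  P.-integrable [set: T] (EFin \o (fun x => Z x * W x)).
Proof.
move=> mZ Z0K.
have -> : EFin \o (fun x => Z x * W x) = ((EFin \o Z) \* (EFin \o W))%E.
  by apply/funext => x /=; rewrite EFinM.
apply: integrableMr => //.
exists K; split; first exact: num_real.
by move=> M KM x _ /=; have /andP[? ?] := Z0K x; rewrite ger0_norm//; lra.
Qed.

(** Halving argument: if 0 <= Z <= K and A = {Z >= K / 2}, then
Z = Z' + (K / 2) 1_A with 0 <= Z' <= K / 2, and the integral of W over A is
nonnegative.  Hence Z can be replaced by Z', with half the bound; after m steps
the trivial estimate by the L1 norm of W has gained a factor 2^m. *)
Lemma Rintegral_mul_ge0_approx m (Z : T -> R) K :
  measurable_fun [set: T'] (Z : T' -> R) -> (forall x, 0 <= Z x <= K) ->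
  - (K / 2 ^+ m * \int[P]_x `|W x|) <= \int[P]_x (Z x * W x).
Proof.
elim: m Z K => [|m IH] Z K mZ Z0K.
  have mZ' := measurable_fun_coarse mZ.
  have iZW := @integrable_bounded_mul Z K mZ' Z0K.
  have K0 : 0 <= K.
    by have /andP[] := Z0K point; apply: le_trans.
  rewrite expr0 divr1 -RintegralZl//; last first.
    exact: (integrable_norm iW).
  rewrite lerNl; apply: (@le_trans _ _ (`|\int[P]_x (Z x * W x)|)).
    by rewrite lerNl; have := ler_norm (- \int[P]_x (Z x * W x)); rewrite normrN; lra.
  apply: (le_trans (le_normr_Rintegral _ _)) => //.
  apply: le_Rintegral => //.
  - exact: (integrable_norm iZW).
  - by apply: EFin_integrableZl; exact: integrable_norm iW.
  - move=> x _; have /andP[? ?] := Z0K x.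
    by rewrite normrM ger0_norm// ler_wpM2r.
pose A := [set x | K / 2 <= Z x].
have mA : G.-sigma.-measurable A.
  rewrite (_ : A = [set: T'] `&` (Z @^-1` `[K / 2, +oo[)); last first.
    by rewrite setTI; apply/seteqP; split => x /=; rewrite in_itv/= andbT.
  exact: mZ.
pose Z' := (fun x => Z x - K / 2 * \1_A x).
have mZ'0 : @measurable_fun _ _ T' R [set: T'] Z'.
  apply: measurable_funB => //; apply: measurable_funM => //.
have Z'0K x : 0 <= Z' x <= K / 2.
  rewrite /Z' indicE; have /andP[? ?] := Z0K x.
  case: (boolP (x \in A)) => [/set_mem|]; first by rewrite /A/= mulr1 => ?; lra.
  by rewrite notin_setE mulr0 => /negP; rewrite -ltNge => ?; lra.
have := IH Z' _ mZ'0 Z'0K.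
rewrite exprS invfM mulrA => /le_trans; apply.
have mZ' := measurable_fun_coarse mZ'0.
have iZ'W := @integrable_bounded_mul Z' _ mZ' Z'0K.
rewrite [leRHS](_ : _ = \int[P]_x (Z' x * W x + K / 2 * (\1_A x * W x))); last first.
  by apply: eq_Rintegral => x _; rewrite /Z'; ring.
have iAW : P.-integrable [set: T] (EFin \o (fun x => \1_A x * W x)).
  apply: (@integrable_bounded_mul _ 1).
    by apply: measurable_fun_coarse; exact: measurable_indic.
  by move=> x; rewrite indicE; case: (_ \in _); rewrite ?lexx ler01.
rewrite RintegralD//; last first.
  exact: (EFin_integrableZl _ iAW).
rewrite lerDl RintegralZl//; apply: mulr_ge0.
  by have /andP[? ?] := Z0K point; lra.
rewrite (_ : \int[P]_x _ = \int[P]_(x in A) W x); first exact: W0.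
rewrite [RHS]Rintegral_mkcond; apply: eq_Rintegral => x _.
by rewrite patchE indicE; case: (x \in A); rewrite ?mul1r ?mul0r.
Qed.

Lemma Rintegral_mul_ge0 (Z : T -> R) K :
  measurable_fun [set: T'] (Z : T' -> R) -> (forall x, 0 <= Z x <= K) ->
  0 <= \int[P]_x (Z x * W x).
Proof.
move=> mZ Z0K.
set I := \int[P]_x `|W x|.
have cv : - (K / 2 ^+ m * I) @[m --> \oo] --> - (0 * I).
  apply: cvgN; apply: cvgMl.
  rewrite -[0](mulr0 K); apply: cvgMr.
  rewrite (_ : (fun _ => _) = geometric 1 (2^-1)); last first.
    by apply/funext => n /=; rewrite mul1r exprVn.
  by apply: cvg_geometric; rewrite ger0_norm//; lra.
rewrite mul0r oppr0 in cv.
apply: (ler_cvg_to cv (cvg_cst _)).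
by apply: nearW => m; apply: Rintegral_mul_ge0_approx.
Qed.

End pull_out.

(** * The exponential supermartingale *)

(** The positive and the negative parts are compared separately, so that this
applies directly to a version of a conditional expectation, of which only
measurability and the integrals over the sets of G are given. *)
Lemma ae_le_integral (d : measure_display) (T : measurableType d)
    (R : realType) (mu : {measure set T -> \bar R}) (D : set T)
    (g h : T -> \bar R) :
  measurable D -> measurable_fun D g -> measurable_fun D h ->
  {ae mu, forall x, (g x <= h x)%E} ->
  (\int[mu]_(x in D) g x <= \int[mu]_(x in D) h x)%E.
Proof.
move=> mD mg mh gh; rewrite integralE [leRHS]integralE; apply: leeB.
- apply: ae_ge0_le_integral => //; try exact: measurable_funepos.
  apply: filterS gh => x gh _; rewrite !funeposE.
  by rewrite ge_max !le_max gh lexx orbT.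
- apply: ae_ge0_le_integral => //; try exact: measurable_funeneg.
  apply: filterS gh => x gh _; rewrite !funenegE.
  by rewrite ge_max !le_max leeN2 gh lexx orbT.
Qed.

(** One step of the exponential supermartingale, in integrated form: D is the
next increment, v its conditional variance given G, and Y the current value of
the (stopped) process.  With Z = Y e^(- psi v) and
W = psi v - lam D - psi D^2, the quadratic bound on the exponential gives
Z e^(lam D) <= Z (1 + psi v) - Z W <= Y - Z W,
and the integral of Z W is nonnegative. *)
Lemma integral_exp_step (d : measure_display) (T : measurableType d)
    (R : realType) (P : probability T R) (G : set (set T))
    (D v Y : T -> R) (a lam K : R) :
  let psi := (expR (lam * a) - 1 - lam * a) / a ^+ 2 in
  G.-sigma.-measurable `<=` d.-measurable ->
  0 < a -> 0 < lam ->
  P.-integrable [set: T] (EFin \o D) ->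
  P.-integrable [set: T] (EFin \o (fun x => D x ^+ 2)) ->
  P.-integrable [set: T] (EFin \o v) ->
  (forall A, G.-sigma.-measurable A -> \int[P]_(x in A) D x <= 0) ->
  (forall A, G.-sigma.-measurable A ->
     \int[P]_(x in A) (D x ^+ 2) <= \int[P]_(x in A) v x) ->
  {ae P, forall x, D x <= a} ->
  @measurable_fun _ _ (g_sigma_algebraType G) R [set: T] v ->
  (forall x, 0 <= v x) ->
  @measurable_fun _ _ (g_sigma_algebraType G) R [set: T] Y ->
  (forall x, 0 <= Y x <= K) ->
  (\int[P]_x (Y x * expR (lam * D x - psi * v x))%:E <=
   \int[P]_x (Y x)%:E)%E.
Proof.
move=> psi GM a0 lam0 iD iD2 iv D0 D2v Da mv v0 mY YK.
have mv' := measurable_fun_coarse GM mv.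
have mY' := measurable_fun_coarse GM mY.
have mD : measurable_fun [set: T] D by apply/measurable_EFinP; exact: measurable_int iD.
have psi0 : 0 <= psi.
  by rewrite divr_ge0 ?sqr_ge0//; have := expR_ge1Dx (lam * a); lra.
pose Z x := Y x * expR (- (psi * v x)).
pose W x := psi * v x + (- lam * D x + - psi * D x ^+ 2).
have iW1 := EFin_integrableZl psi iv.
have iW2 := EFin_integrableZl (- lam) iD.
have iW3 := EFin_integrableZl (- psi) iD2.
have iW23 := integrableD measurableT iW2 iW3.
have iW : P.-integrable [set: T] (EFin \o W) := integrableD measurableT iW1 iW23.
have sub (h : T -> R) (A : set T) : measurable A ->
    P.-integrable [set: T] (EFin \o h) -> P.-integrable A (EFin \o h).
  by move=> mA; apply: integrableS.
have W0 A : G.-sigma.-measurable A -> 0 <= \int[P]_(x in A) W x.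
  move=> mA; have mA' := GM _ mA.
  rewrite RintegralD//; [|exact: sub iW1|exact: sub iW23].
  rewrite RintegralD//; [|exact: sub iW2|exact: sub iW3].
  rewrite !RintegralZl//; try exact: sub.
  have := ler_wpM2l psi0 (D2v _ mA).
  have := ler_wpM2l (ltW lam0) (D0 _ mA); lra.
have mZ : @measurable_fun _ _ (g_sigma_algebraType G) R [set: T] Z.
  apply: measurable_funM => //; apply: measurableT_comp => //.
  by apply: measurableT_comp => //; exact: measurable_funM.
have mZ' := measurable_fun_coarse GM mZ.
have ZK x : 0 <= Z x <= K.
  have /andP[Y0 YK'] := YK x.
  rewrite /Z mulr_ge0 ?expR_ge0//=; apply: le_trans YK'.
  by rewrite ler_piMr// -expR0 ler_expR oppr_le0 mulr_ge0.
have iZW := integrable_bounded_mul iW mZ' ZK.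
have ZW0 := Rintegral_mul_ge0 GM iW W0 mZ ZK.
have iY : P.-integrable [set: T] (EFin \o Y).
  apply: measurable_bounded_integrable => //.
    by rewrite (le_lt_trans (probability_le1 _ _))// ltry.
  exists K; split; first exact: num_real.
  by move=> M KM x _ /=; have /andP[? ?] := YK x; rewrite ger0_norm//; lra.
apply: (@le_trans _ _ (\int[P]_x (Y x - Z x * W x)%:E)%E); last first.
  rewrite integralB_EFin// leeBlDr; last exact: integrable_fin_num.
  rewrite leeDl// -[leRHS]fineK ?lee_fin//; exact: integrable_fin_num.
apply: ae_le_integral => //.
- apply/measurable_EFinP; apply: measurable_funM => //.
  apply: measurableT_comp => //.
  by apply: measurable_funB; exact: measurable_funM.
- apply/measurable_EFinP; apply: measurable_funB => //.
  by apply/measurable_EFinP; exact: measurable_int iZW.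
apply: filterS Da => x Da; rewrite lee_fin expRD mulrA mulrAC -/(Z x).
have -> : Y x = Z x * expR (psi * v x).
  by rewrite /Z -mulrA -expRD addNr expR0 mulr1.
rewrite -mulrBr; apply: ler_wpM2l; first by have /andP[] := ZK x.
have c0 : 0 < lam * a by rewrite mulr_gt0.
have xc : lam * D x <= lam * a by rewrite ler_pM2l.
have := @expR_quadratic_bound R _ _ c0 xc.
have := expR_ge1Dx (psi * v x).
have -> : (expR (lam * a) - 1 - lam * a) / (lam * a) ^+ 2 * (lam * D x) ^+ 2 = psi * D x ^+ 2.
  by rewrite /psi; field; rewrite !gt_eqF.
by rewrite /W; lra.
Qed.

(** * The maximal inequality over a finite horizon *)

Section maximal_inequality.
Context {d : measure_display} {T : measurableType d} {R : realType}.
Variables (P : probability T R) (F : nat -> set (set T)).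
Variables (f v : nat -> T -> R) (a b lam r : R).
Let D n x := f n.+1 x - f n x.
Let psi := (expR (lam * a) - 1 - lam * a) / a ^+ 2.
Hypothesis FM : forall n, (F n).-sigma.-measurable `<=` d.-measurable.
Hypothesis Fle : forall m n, (m <= n)%N ->
  (F m).-sigma.-measurable `<=` (F n).-sigma.-measurable.
Hypotheses (a0 : 0 < a) (lam0 : 0 < lam) (r0 : 0 < r).
Hypothesis f0 : forall x, f 0%N x = 0.
Hypothesis mf : forall n,
  @measurable_fun _ _ (g_sigma_algebraType (F n)) R [set: T] (f n).
Hypothesis mv : forall n,
  @measurable_fun _ _ (g_sigma_algebraType (F n)) R [set: T] (v n).
Hypothesis v0 : forall n x, 0 <= v n x.
Hypothesis iD : forall n, P.-integrable [set: T] (EFin \o D n).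
Hypothesis iD2 : forall n,
  P.-integrable [set: T] (EFin \o (fun x => D n x ^+ 2)).
Hypothesis iv : forall n, P.-integrable [set: T] (EFin \o v n).
Hypothesis D0 : forall n A, (F n).-sigma.-measurable A ->
  \int[P]_(x in A) D n x <= 0.
Hypothesis D2v : forall n A, (F n).-sigma.-measurable A ->
  \int[P]_(x in A) (D n x ^+ 2) <= \int[P]_(x in A) v n x.
Hypothesis Da : forall n, {ae P, forall x, D n x <= a}.
Hypothesis vb : {ae P, forall x, forall n, \sum_(i < n) v i x <= b}.

Let S n x := \sum_(i < n) v i x.
Let M n x := expR (lam * f n x - psi * S n x).
Let B n := [set x | forall k, (k <= n)%N -> f k x < r].
Let Y n x := \1_(B n) x * M n x.

Let mF (h : T -> R) m n : (m <= n)%N ->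
  @measurable_fun _ _ (g_sigma_algebraType (F m)) R [set: T] h ->
  @measurable_fun _ _ (g_sigma_algebraType (F n)) R [set: T] h.
Proof. by move=> mn mh mT A mA; apply: (Fle mn); exact: mh. Qed.

Let BS n : B n.+1 = B n `&` [set x | f n.+1 x < r].
Proof.
apply/seteqP; split => x /=.
  by move=> h; split; [move=> k kn; apply: h; exact: leqW|exact: h].
by move=> [h1 h2] k; rewrite leq_eqVlt => /predU1P[->//|]; exact: h1.
Qed.

Let mlt n : (F n).-sigma.-measurable [set x | f n x < r].
Proof.
rewrite (_ : [set x | _] = [set: T] `&` f n @^-1` `]-oo, r[%classic).
  exact: mf.
by rewrite setTI; apply/seteqP; split => x /=; rewrite in_itv.
Qed.

Let mB n : (F n).-sigma.-measurable (B n).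
Proof.
elim: n => [|n IH].
  rewrite (_ : B 0 = [set x | f 0 x < r]); first exact: mlt.
  apply/seteqP; split => x /=; first by apply.
  by move=> h k; rewrite leqn0 => /eqP ->.
by rewrite BS; apply: measurableI; [exact: Fle IH|exact: mlt].
Qed.

Let mS n : @measurable_fun _ _ (g_sigma_algebraType (F n)) R [set: T] (S n).
Proof.
by apply: measurable_sum => i; exact: mF (ltnW (ltn_ord i)) (@mv i).
Qed.

Let mM n : @measurable_fun _ _ (g_sigma_algebraType (F n)) R [set: T] (M n).
Proof.
apply: measurableT_comp => //.
by apply: measurable_funB; apply: measurable_funM.
Qed.

Let mY n : @measurable_fun _ _ (g_sigma_algebraType (F n)) R [set: T] (Y n).
Proof. by apply: measurable_funM => //; exact: measurable_indic. Qed.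

Let psi0 : 0 <= psi.
Proof.
by rewrite divr_ge0 ?sqr_ge0//; have := expR_ge1Dx (lam * a); lra.
Qed.

Let YK n x : 0 <= Y n x <= expR (lam * r).
Proof.
rewrite /Y indicE; have [/set_mem Bx|_] := boolP (x \in B n); last first.
  by rewrite mul0r lexx expR_ge0.
rewrite mul1r expR_ge0 ler_expR.
have : lam * f n x <= lam * r by rewrite ler_pM2l// ltW//; exact: Bx.
have : 0 <= psi * S n x by rewrite mulr_ge0// sumr_ge0.
lra.
Qed.

Let c := expR (lam * r - psi * b).
(** U n lies below the process M stopped when f first reaches r: on the paths
that have already done so it is frozen at c, the lower bound of M at that
time. *)
Let U n x := Y n x + c * \1_(~` B n) x.

Let mcB n : measurable_fun [set: T] (fun x => (c * \1_(~` B n) x)%:E).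
Proof.
apply/measurable_EFinP; apply: measurable_funM => //.
by apply: measurable_indic; apply: measurableC; apply: FM.
Qed.

Let mYexp n : measurable_fun [set: T]
  (fun x => (Y n x * expR (lam * D n x - psi * v n x))%:E).
Proof.
apply/measurable_EFinP; apply: measurable_funM.
  exact: (measurable_fun_coarse (@FM _) (@mY _)).
apply: measurableT_comp => //; apply: measurable_funB.
  apply: measurable_funM => //.
  by apply/measurable_EFinP; exact: measurable_int (iD _).
apply: measurable_funM => //.
exact: (measurable_fun_coarse (@FM _) (@mv _)).
Qed.

Let integral_U n : (\int[P]_x (U n x)%:E <= 1)%E.
Proof.
elim: n => [|n]; last first.
  apply: le_trans.
  apply: (@le_trans _ _ (\int[P]_x
    ((Y n x * expR (lam * D n x - psi * v n x))%:E
     + (c * \1_(~` B n) x)%:E))%E).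
    apply: ae_le_integral => //.
    + apply/measurable_EFinP; apply: measurable_funD.
        exact: (measurable_fun_coarse (@FM _) (@mY _)).
      by apply/measurable_EFinP; exact: (@mcB _).
    + exact: emeasurable_funD (mYexp n) (@mcB n).
    apply: filterS vb => x /(_ n.+1) vbx; rewrite -EFinD lee_fin.
    have YM : M n x * expR (lam * D n x - psi * v n x) = M n.+1 x.
      by rewrite -expRD /M /S big_ord_recr/=; congr expR; rewrite /D /S; ring.
    (* The two sides differ only on the paths that first reach r at time
       n + 1, where the constant c has to be at most M n.+1 x. *)
    rewrite /U /Y !indicE -mulrA YM !in_setC.
    have [/set_mem Bx1|nBx1] := boolP (x \in B n.+1).
      by rewrite mem_set//; move: Bx1; rewrite BS => -[].
    have [/set_mem Bx|nBx] := boolP (x \in B n); last by [].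
    rewrite /= mul0r mul1r mulr1 mulr0 add0r addr0 ler_expR.
    have fr : r <= f n.+1 x.
      rewrite leNgt; apply/negP => fr; move/negP: nBx1; apply.
      by rewrite inE BS; split.
    have := ler_wpM2l psi0 vbx.
    by have : lam * r <= lam * f n.+1 x; [rewrite ler_pM2l|rewrite /S; lra].
  rewrite ge0_integralD//.
  - rewrite [leRHS](_ : _ =
        \int[P]_x ((Y n x)%:E + (c * \1_(~` B n) x)%:E))%E; last first.
      by apply: eq_integral => x _; rewrite EFinD.
    rewrite ge0_integralD//.
    + apply: leeD2r; apply: (integral_exp_step (@FM n)) (YK n) => //.
        exact: D0.
      exact: D2v.
    + by move=> x _; rewrite lee_fin; have /andP[] := YK n x.
    + by apply/measurable_EFinP; exact: (measurable_fun_coarse (@FM _) (@mY _)).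
    + by move=> x _; rewrite lee_fin mulr_ge0 ?expR_ge0.
  - by move=> x _; rewrite lee_fin mulr_ge0 ?expR_ge0//; have /andP[] := YK n x.
  - by move=> x _; rewrite lee_fin mulr_ge0 ?expR_ge0.
rewrite (eq_integral (cst 1%E)).
  by rewrite integral_cst// mul1e probability_le1.
move=> x _ ; rewrite /U /Y /M /S big_ord0 f0 !mulr0 subr0 expR0 mulr1 !indicE.
have Bx : B 0 x by move=> k; rewrite leqn0 => /eqP ->; rewrite f0.
by rewrite (mem_set Bx) memNset ?mulr0 ?addr0.
Qed.

(** Markov's inequality for U n, which equals c once r has been reached. *)
Lemma finite_horizon_bound n :
  (P [set x | exists2 k, (k <= n)%N & (r <= f k x)%R] <=
   (expR (psi * b - lam * r))%:E)%E.
Proof.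
rewrite (_ : [set x | _] = ~` B n); last first.
  apply/seteqP; split => x /=.
    by move=> [k kn rf] /(_ k kn); rewrite ltNge rf.
  move=> /existsNP[k /not_implyP[kn /negP]]; rewrite -leNgt => rf.
  by exists k.
have mC : measurable (~` B n) by apply: measurableC; exact: FM.
rewrite -opprB expRN -/c -[leRHS]mule1 lee_pdivlMl ?expR_gt0//.
apply: le_trans (integral_U n).
rewrite -[X in (_ * P X)%E]setIT -integral_indic// -ge0_integralZl//.
- apply: ge0_le_integral => //.
  + by move=> x _; rewrite -EFinM lee_fin mulr_ge0 ?expR_ge0.
  + exact: (@mcB n).
  + apply/measurable_EFinP; apply: measurable_funD.
      exact: (measurable_fun_coarse (@FM _) (@mY _)).
    by apply/measurable_EFinP; exact: (@mcB _).
  + move=> x _; rewrite -EFinM lee_fin lerDr.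
    by have /andP[] := YK n x.
- by apply/measurable_EFinP; exact: measurable_indic.
- by rewrite lee_fin expR_ge0.
Qed.

End maximal_inequality.

(** * From finite horizons to the supremum *)

Lemma measurable_maxfun (d : measure_display) (T : measurableType d)
    (R : realType) (f : nat -> T -> R) :
  (forall n, measurable_fun [set: T] (f n)) ->
  measurable_fun [set: T] (maxfun f).
Proof.
move=> mf.
rewrite (_ : maxfun f = fun x => esups ((fun n x => (f n x)%:E) ^~ x) 0%N).
  by apply: measurable_fun_esups => n; exact/measurable_EFinP.
apply/funext => x; rewrite /maxfun /esups /sdrop/=; congr ereal_sup.
by apply/seteqP; split => _ [n _ <-]; exists n.
Qed.

(** The supremum may equal r without being attained, so the event is covered by
the events that f reaches r' at some finite time, for any r' < r; the bound
is continuous in r'. *)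
Lemma prob_maxfun_le (d : measure_display) (T : measurableType d)
    (R : realType) (P : probability T R) (f : nat -> T -> R) (r lam c : R) :
  (forall n, measurable_fun [set: T] (f n)) -> 0 < r ->
  (forall r' n, 0 < r' ->
    (P [set x | exists2 k, (k <= n)%N & (r' <= f k x)%R] <=
     (expR (c - lam * r'))%:E)%E) ->
  (P [set x | (r%:E <= maxfun f x)%E] <= (expR (c - lam * r))%:E)%E.
Proof.
move=> mf r0 Pn.
set E := [set x | _].
have mE : measurable E.
  rewrite -[E]setTI; apply: emeasurable_fun_c_infty => //.
  exact: measurable_maxfun.
suff H r' : 0 < r' -> r' < r -> fine (P E) <= expR (c - lam * r').
  rewrite -[leLHS]fineK ?fin_num_measure// lee_fin.
  have cv : expR (c - lam * r') @[r' --> r^'-] --> expR (c - lam * r).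
    apply: cvg_at_left_filter; apply: continuous_cvg; first exact: continuous_expR.
    by apply: cvgB; [exact: cvg_cst|apply: cvgMr; exact: cvg_id].
  apply: (ler_cvg_to (cvg_cst _) cv).
  near=> r'; apply: H; near: r'.
  - exact: nbhs_left_gt.
  - exact: nbhs_left_lt.
move=> r'0 r'r; rewrite -lee_fin fineK ?fin_num_measure//.
pose En n := [set x | exists2 k, (k <= n)%N & (r' <= f k x)%R].
have mEn n : measurable (En n).
  rewrite (_ : En n = \bigcup_(k in `I_n.+1) ([set: T] `&` f k @^-1` `[r', +oo[)).
    apply: bigcup_measurable => k _; exact: mf.
  apply/seteqP; split => x /= [k kn] fk.
    by exists k => //; split => //=; rewrite in_itv/= fk.
  by exists k => //; move: fk => [_]/=; rewrite in_itv/= andbT.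
have mU : measurable (\bigcup_n En n) by exact: bigcup_measurable.
apply: (@le_trans _ _ (P (\bigcup_n En n))).
  apply: le_measure; rewrite ?inE//.
  move=> x; rewrite /E/= => rx.
  have /ereal_sup_gt[_ [k _ <-]] : (r'%:E < maxfun f x)%E.
    by rewrite (lt_le_trans _ rx)// lte_fin.
  by rewrite lte_fin => /ltW rk; exists k => //; exists k.
have cv : (P \o En) x @[x --> \oo] --> P (\bigcup_n En n).
  apply: nondecreasing_cvg_mu => // m n mn; apply/subsetPset => x [k km fk].
  by exists k => //; exact: leq_trans mn.
rewrite -(cvg_lim _ cv)//; apply: lime_le; first exact: cvgP cv.
by apply: nearW => n; exact: Pn.
Unshelve. all: by end_near. Qed.

(** * Versions of conditional expectations *)

Section cond_exp.
Context {d : measure_display} {T : measurableType d} {R : realType}.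
Variables (P : probability T R) (G : set (set T)) (X Y : T -> \bar R).
Hypothesis GM : G.-sigma.-measurable `<=` d.-measurable.
Hypothesis sG : sigma_algebra [set: T] G.
Hypothesis XY : is_cond_exp P G X Y.

Lemma cond_exp_measurable_coarse :
  @measurable_fun _ _ (g_sigma_algebraType G) (\bar R) [set: T] Y.
Proof.
by move=> mT B mB; apply: sub_sigma_algebra; apply: XY.1; exists B.
Qed.

Lemma cond_exp_measurable : @measurable_fun _ _ T (\bar R) [set: T] Y.
Proof. by move=> mT B mB; apply: GM; exact: cond_exp_measurable_coarse. Qed.

(** The set where Y is negative belongs to G, so the integral of Y over it equals
that of X, which is nonnegative: this forces the set to be negligible. *)
Lemma cond_exp_ge0 : (forall x, (0 <= X x)%E) ->
  {ae P, forall x, (0 <= Y x)%E}.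
Proof.
move=> X0; pose A := [set x | (Y x < 0)%E].
have mA : G.-sigma.-measurable A.
  rewrite (_ : A = [set: T] `&` Y @^-1` `]-oo, 0%E[); last first.
    by rewrite setTI; apply/seteqP; split => x /=; rewrite in_itv.
  by apply: cond_exp_measurable_coarse => //; exact: emeasurable_itv.
have mA' := GM mA.
have GA : G A by rewrite -(sigma_algebra_id sG).
have : (\int[P]_(x in A) `|Y x| = 0)%E.
  apply/eqP; rewrite eq_le integral_ge0// andbT.
  rewrite -oppe_ge0 -integral_ge0N//.
  rewrite (eq_integral Y); first by rewrite XY.2// integral_ge0.
  by move=> x /set_mem Ax; rewrite lte0_abs// oppeK.
move=> /ae_eq_integral_abs; move=> /(_ mA').
have mYA : measurable_fun A Y.
  exact: measurable_funS cond_exp_measurable.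
move=> /(_ mYA); apply: filterS => x h.
by rewrite leNgt; apply/negP => Yx; move: (Yx); rewrite h// ltxx.
Qed.

End cond_exp.

Lemma ae_le_Lnormy (d : measure_display) (T : measurableType d)
    (R : realType) (P : probability T R) (g : T -> \bar R) (c : \bar R) :
  ('N[P]_+oo [g] <= c)%E -> {ae P, forall x, (g x <= c)%E}.
Proof.
have P0 : (0 < P [set: T])%E by rewrite probability_setT.
rewrite unlock; case: ifPn => [_ /ess_supP|]; last by rewrite P0.
by apply: filterS => x; apply: le_trans; exact: lee_abs.
Qed.

Section cond_exp_fine.
Context {d : measure_display} {T : measurableType d} {R : realType}.
Variables (P : probability T R) (G : set (set T)) (X : T -> R).
Variables (V : T -> \bar R) (b : R).
Hypothesis GM : G.-sigma.-measurable `<=` d.-measurable.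
Hypothesis sG : sigma_algebra [set: T] G.
Hypothesis XV : is_cond_exp P G (EFin \o X) V.
Hypothesis mX : measurable_fun [set: T] X.
Hypothesis X0 : forall x, 0 <= X x.
Hypothesis b0 : 0 <= b.
Hypothesis Vb : {ae P, forall x, (V x <= b%:E)%E}.

(** A real-valued version of V that is nonnegative everywhere, and still
   G-measurable. *)
Let v x := `|fine (V x)|.

Lemma measurable_norm_fine :
  @measurable_fun _ _ (g_sigma_algebraType G) R [set: T] v.
Proof.
apply: measurableT_comp => //; apply: measurableT_comp => //.
exact: cond_exp_measurable_coarse XV.
Qed.

Lemma ae_cond_exp_bounds : {ae P, forall x, (0 <= V x <= b%:E)%E}.
Proof.
have V0 : {ae P, forall x, (0 <= V x)%E}.
  by apply: (cond_exp_ge0 GM sG XV) => x; rewrite lee_fin.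
by apply: filterS2 V0 Vb => x -> ->.
Qed.

Lemma ae_norm_fine : {ae P, forall x, V x = (v x)%:E}.
Proof.
apply: filterS ae_cond_exp_bounds => x /andP[h1 h2].
rewrite /v ger0_norm ?fine_ge0// fineK//.
by rewrite ge0_fin_numE// (le_lt_trans h2)// ltry.
Qed.

Let mv : measurable_fun [set: T] v.
Proof. exact: measurable_fun_coarse measurable_norm_fine. Qed.

Lemma integrable_norm_fine : P.-integrable [set: T] (EFin \o v).
Proof.
apply/integrableP; split; first exact/measurable_EFinP.
apply: (@le_lt_trans _ _ (b%:E * P [set: T])%E).
  apply: integral_le_bound => //; first exact/measurable_EFinP.
  apply: filterS2 ae_cond_exp_bounds ae_norm_fine => x + Vv _ /=.
  by rewrite Vv !lee_fin normr_id => /andP[].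
by rewrite probability_setT mule1 ltry.
Qed.

Lemma integral_norm_fine A : G.-sigma.-measurable A ->
  (\int[P]_(x in A) (v x)%:E = \int[P]_(x in A) (X x)%:E)%E.
Proof.
move=> mA; rewrite -[RHS]XV.2; last by rewrite -(sigma_algebra_id sG).
apply: ae_eq_integral; first exact: GM.
- by apply: measurable_funTS; exact/measurable_EFinP.
- by apply: measurable_funTS; exact: cond_exp_measurable XV.
- by apply: filterS ae_norm_fine => x ->.
Qed.

(** The integral of X is that of v, which is at most b almost everywhere. *)
Lemma integrable_bounded_cond_exp : P.-integrable [set: T] (EFin \o X).
Proof.
apply/integrableP; split; first exact/measurable_EFinP.
have /integrableP[_] := integrable_norm_fine; congr (_ < _)%E.
transitivity (\int[P]_x (v x)%:E)%E.
  by apply: eq_integral => x _; rewrite /= normr_id.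
rewrite integral_norm_fine; last exact: measurableT.
by apply: eq_integral => x _; rewrite /= ger0_norm.
Qed.

End cond_exp_fine.

(** * Optimizing the exponent *)

Section exponent.
Variable R : realType.
Implicit Types a b r : R.

(** The derivative in lam of psi(lam) b^2 - lam r vanishes when
e^(lam a) = 1 + r a / b^2. *)
Lemma optimal_exponent a b r : 0 < a -> 0 < b -> 0 < r ->
  let lam := ln (1 + r * a / b ^+ 2) / a in
  (expR (lam * a) - 1 - lam * a) / a ^+ 2 * b ^+ 2 - lam * r =
  r / a - (r / a + b ^+ 2 / a ^+ 2) * ln (1 + r * a / b ^+ 2).
Proof.
move=> a0 b0 r0 lam.
have an0 : a != 0 by rewrite gt_eqF.
have bn0 : b != 0 by rewrite gt_eqF.
rewrite /lam mulfVK// lnK; last first.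
  by rewrite posrE addr_gt0// divr_gt0 ?mulr_gt0// exprn_gt0.
by field; rewrite an0 bn0.
Qed.

Lemma optimal_bound_le_powR a b r : 0 < a -> 0 < b -> 0 < r ->
  expR (r / a - (r / a + b ^+ 2 / a ^+ 2) * ln (1 + r * a / b ^+ 2)) <=
  (expR 1 * b ^+ 2 / (r * a)) `^ (r / a).
Proof.
move=> a0 b0 r0.
have u0 : 0 < r * a / b ^+ 2 by rewrite divr_gt0 ?mulr_gt0// exprn_gt0.
set u := r * a / b ^+ 2 in u0 *.
have -> : expR 1 * b ^+ 2 / (r * a) = expR (1 - ln u).
  rewrite expRB lnK ?posrE// /u; field.
  by rewrite !gt_eqF.
rewrite -expRM ler_expR.
have l1 : ln u <= ln (1 + u).
  by rewrite ler_ln ?posrE ?lerDr ?ler01// addr_gt0.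
have l2 : 0 <= ln (1 + u) by rewrite ln_ge0// lerDl ltW.
have ra : 0 <= r / a by rewrite divr_ge0 ?ltW.
have ba : 0 <= b ^+ 2 / a ^+ 2 by rewrite divr_ge0 ?sqr_ge0.
have := ler_wpM2l ra l1.
have := mulr_ge0 ba l2.
by rewrite mulrDl [X in _ -> _ -> _ <= X]mulrC mulrBr mulr1; lra.
Qed.

End exponent.

Theorem theorem8p2 (d : measure_display) (T : measurableType d) (R : realType)
    (P : probability T R) (F : nat -> set (set T)) (f : nat -> T -> R)
    (s2 : T -> \bar R) (a b : R) :
  Mminus P F f ->
  is_s2 P F f s2 ->
  0 < a -> 0 < b ->
  ('N[P]_+oo [maxfun (diffseq f)] <= a%:E)%E ->
  ('N[P]_+oo [s2] <= b%:E)%E ->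
  forall r : R, 0 <= r ->
    (P [set x | (r%:E <= maxfun f x)%E]
       <= (expR (r / a - (r / a + b ^+ 2 / a ^+ 2)
                         * ln (1 + r * a / b ^+ 2)))%:E)%E
    /\ expR (r / a - (r / a + b ^+ 2 / a ^+ 2) * ln (1 + r * a / b ^+ 2))
       <= (if r == 0 then 1
           else (expR 1 * b ^+ 2 / (r * a)) `^ (r / a)).
Proof.
move=> [[filtF adF intF supF] f0] [V VE s2E] a0 b0 da sb r r_ge0.
have [sF FM Fle] := filtF.
have sFE n : (F n).-sigma.-measurable = F n by exact: sigma_algebra_id.
have GM n : (F n).-sigma.-measurable `<=` d.-measurable by rewrite sFE.
have Gle m n : (m <= n)%N ->
    (F m).-sigma.-measurable `<=` (F n).-sigma.-measurable.
  by move=> mn; rewrite !sFE; exact: Fle.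
have mf n : @measurable_fun _ _ (g_sigma_algebraType (F n)) R [set: T] (f n).
  by move=> mT B mB; apply: sub_sigma_algebra; apply: (adF n); exists B.
have mf' n := measurable_fun_coarse (@GM n) (@mf n).
have [->|rn0] := eqVneq r 0.
  rewrite !mul0r addr0 ln1 mulr0 subr0 expR0; split => //.
  apply: probability_le1; rewrite -[X in measurable X]setTI.
  by apply: emeasurable_fun_c_infty => //; exact: measurable_maxfun.
have r0 : 0 < r by rewrite lt_neqAle eq_sym rn0.
split; last exact: optimal_bound_le_powR.
have md2 n : measurable_fun [set: T] (fun x => (f n.+1 x - f n x) ^+ 2).
  by apply: measurable_funX; exact: measurable_funB.
have VE' n : is_cond_exp P (F n)
    (EFin \o (fun x => (f n.+1 x - f n x) ^+ 2)) (V n.+1).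
  exact: (VE n.+1).
have Vge0 : {ae P, forall x, forall n, (0 <= V n.+1 x)%E}.
  apply: ae_foralln => n; apply: (cond_exp_ge0 (@GM n) (sF n) (VE' n)) => x.
  by rewrite lee_fin sqr_ge0.
(* The infinite sum bounds its partial sums only where all terms are
   nonnegative, which holds almost everywhere. *)
have VSb : {ae P, forall x, forall n,
    (\sum_(i < n) V i.+1 x <= (b ^+ 2)%:E)%E}.
  apply: filterS2 Vge0 (ae_le_Lnormy sb) => x V0 s2b n.
  have <- : (\sum_(1 <= j < n.+1) V j x = \sum_(i < n) V i.+1 x)%E.
    by rewrite big_add1 big_mkord.
  apply: (@le_trans _ _ (\sum_(1 <= j <oo) V j x)%E).
    by apply: nneseries_lim_ge => -[].
  by rewrite -lee_sqrt ?lee_fin ?sqr_ge0//= sqrtr_sqr gtr0_norm// -s2E.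
have Vb n : {ae P, forall x, (V n.+1 x <= (b ^+ 2)%:E)%E}.
  apply: filterS2 Vge0 VSb => x V0 /(_ n.+1); apply: le_trans.
  by rewrite big_ord_recr/= leeDr// sume_ge0.
pose v n x := `|fine (V n.+1 x)|.
have b20 : 0 <= b ^+ 2 by exact: sqr_ge0.
have d20 n x : 0 <= (f n.+1 x - f n x) ^+ 2 by exact: sqr_ge0.
pose lam := ln (1 + r * a / b ^+ 2) / a.
have lam0 : 0 < lam.
  by rewrite divr_gt0// ln_gt0// ltrDl divr_gt0 ?mulr_gt0 ?exprn_gt0.
rewrite -optimal_exponent// -/lam.
have iD n : P.-integrable [set: T] (EFin \o (fun x => f n.+1 x - f n x)).
  rewrite (_ : _ \o _ = (EFin \o f n.+1) \- (EFin \o f n))%E; last first.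
    by apply/funext => x /=; rewrite EFinB.
  by apply: integrableB.
have id2 n := integrable_bounded_cond_exp (@GM n) (sF n) (VE' n) (md2 n)
  (d20 n) b20 (Vb n).
have iv n := integrable_norm_fine (@GM n) (sF n) (VE' n) (d20 n) b20 (Vb n).
apply: prob_maxfun_le => // r' n r'0.
apply: (@finite_horizon_bound _ _ _ P F f v a (b ^+ 2) lam r') => //.
- by move=> k; exact: measurable_norm_fine (VE' k).
- by move=> k x; exact: normr_ge0.
- move=> k A mA; have mA' := GM _ _ mA.
  rewrite RintegralB//; [|exact: integrableS (intF _)..].
  rewrite subr_le0 fine_le//; try by apply: integrable_fin_num => //; exact: integrableS (intF _).
  have [W WE Wf] := supF k.
  rewrite -[leLHS]WE.2; last by rewrite -sFE.
  apply: ae_le_integral => //.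
  + by apply: measurable_funTS; exact: (cond_exp_measurable (@GM k) WE).
  + by apply: measurable_funTS; exact/measurable_EFinP.
- move=> k A mA.
  by rewrite /Rintegral -(integral_norm_fine (@GM k) (sF k) (VE' k) (d20 k) (Vb k)).
- move=> k; apply: filterS (ae_le_Lnormy da) => x.
  rewrite -lee_fin; apply: le_trans; apply: ereal_sup_ubound.
  by exists k.+1.
have vE n' := ae_norm_fine (@GM n') (sF n') (VE' n') (d20 n') (Vb n').
apply: filterS2 (ae_foralln vE) VSb => x Vv VSx k.
rewrite -lee_fin; apply: le_trans (VSx k).
by rewrite -sumEFin; under [leRHS]eq_bigr do rewrite Vv.
Qed.
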